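(* There exists a distribution-valued game $G$ such that (i) $G$ is a two-player game with tail-order preferences, (ii) the payoffs of $G$ are distributions (probability measures) with finite support, and (iii) $G$ has no Nash equilibrium (in mixed strategies) with respect to $\preceq$.
   Context: $\mathcal{D}_{\mathrm{co}}$ is the set of finite positive Borel measures $\mu$ on $[0,\infty)$ for which there exist $0<a<b<\infty$ with $\operatorname{supp}\mu\subset[a,b]$. The moments are $s_n(\mu)=\int_0^\infty t^n\,d\mu(t)$, $n\in\mathbb{N}=\{0,1,2,\dots\}$. The tail order is defined by: $\mu_1\preceq\mu_2$ if and only if there is $n_0\in\mathbb{N}$ such that $s_n(\mu_1)\le s_n(\mu_2)$ for all $n\ge n_0$; $\mu\succeq\nu$ means $\nu\preceq\mu$. A (finite) two-player distribution-valued game consists of finite nonempty sets $V_1,V_2$ of (pure) strategies of Players 1 and 2 and payoff functions $u_1,u_2:V_1\times V_2\to\mathcal{D}_{\mathrm{co}}$. A mixed strategy of Player $k$ is a formal convex combination of the pure strategies in $V_k$; the set of these is $\Sigma(V_k)$, and the $u_k$ are extended to $\Sigma(V_1)\times\Sigma(V_2)$ affinely in each argument. As in a zero-sum game, both players receive identical payoffs, $u_1=u_2=:u$, and the players are antagonistic: Player 1 prefers payoffs that are large with respect to $\preceq$, Player 2 prefers payoffs that are small with respect to $\preceq$ (tail-order preferences). A Nash equilibrium with respect to $\preceq$ is a mixed strategy profile $(v_1,v_2)\in\Sigma(V_1)\times\Sigma(V_2)$ such that $u(\tilde v_1,v_2)\preceq u(v_1,v_2)$ for all $\tilde v_1\in\Sigma(V_1)$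 and $u(v_1,\tilde v_2)\succeq u(v_1,v_2)$ for all $\tilde v_2\in\Sigma(V_2)$. *)

(* Defs.v *)
From HB Require Import structures.
From mathcomp Require Import all_boot all_order all_algebra.
From mathcomp Require Import all_classical all_reals all_analysis.
From mathcomp Require Import measurable_realfun.
Import Order.TTheory GRing.Theory Num.Theory.
Import numFieldNormedType.Exports.

Set Implicit Arguments.
Unset Strict Implicit.
Unset Printing Implicit Defensive.

Local Open Scope classical_set_scope.
Local Open Scope ring_scope.

Definition supp (R : realType) (mu : set (measurableTypeR R) -> \bar R) :
    set R :=
  [set x | forall U : set R, open U -> U x -> (0 < mu U)%E].

(* The half-line is encoded inside the real line: a finite Borel measure on
   [0, +oo[ with support in [a, b], 0 < a, is identified with its extension
   by zero. *)
Record dco (R : realType) := Dco {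
  dco_measure :> {finite_measure set (measurableTypeR R) -> \bar R};
  dco_supp : exists a b : R,
    [/\ 0 < a, a < b & supp dco_measure `<=` `[a, b]] }.

Definition moment (R : realType) (mu : dco R) (n : nat) : \bar R :=
  (\int[mu]_(t in `[0%R, +oo[) ((t : R) ^+ n)%:E)%E.

Definition tail_le (R : realType) (mu1 mu2 : dco R) : Prop :=
  exists n0 : nat, forall n : nat,
    (n0 <= n)%N -> (moment mu1 n <= moment mu2 n)%E.

Record mixed (R : realType) (V : finType) := Mixed {
  mixed_weight :> {ffun V -> R};
  mixed_ge0 : forall v, 0 <= mixed_weight v;
  mixed_sum1 : \sum_v mixed_weight v = 1 }.

Section Mixture.
Context (R : realType) (V : finType) (s : mixed R V) (m : V -> dco R).
Local Open Scope ereal_scope.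

Definition mixture (A : set (measurableTypeR R)) : \bar R :=
  \sum_v (s v)%:E * m v A.

Let mixture0 : mixture set0 = 0.
Proof. by rewrite /mixture big1 // => v _; rewrite measure0 mule0. Qed.

Let mixture_ge0 A : 0 <= mixture A.
Proof.
by apply: sume_ge0 => v _; rewrite mule_ge0// lee_fin mixed_ge0.
Qed.

Let mixture_sigma_additive : semi_sigma_additive mixture.
Proof.
move=> F mF tF mUF; rewrite [X in _ --> X](_ : _ =
    lim ((fun n => \sum_(0 <= i < n) mixture (F i)) @ \oo)).
  by apply: is_cvg_ereal_nneg_natsum => k _; exact: mixture_ge0.
rewrite nneseries_sum; last first.
  by move=> v k _; rewrite mule_ge0// lee_fin mixed_ge0.
apply: eq_bigr => /= v _.
exact: (@measure_semi_bigcup _ _ _ (mscale (NngNum (mixed_ge0 s v)) (m v))).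
Qed.

HB.instance Definition _ := isMeasure.Build _ _ _ mixture
  mixture0 mixture_ge0 mixture_sigma_additive.

Let mixture_fin : fin_num_fun mixture.
Proof.
move=> A mA; rewrite /mixture; apply/sum_fin_numP => v _ _.
by rewrite fin_numM// fin_num_measure.
Qed.

HB.instance Definition _ := @Measure_isFinite.Build _ _ _ mixture mixture_fin.

Let supp_mixture : exists a b : R,
  [/\ (0 < a)%R, (a < b)%R & supp mixture `<=` `[a, b]].
Proof.
have /boolp.choice[f /= fP] : forall v, exists ab : R * R,
    [/\ (0 < ab.1)%R, (ab.1 < ab.2)%R & supp (m v) `<=` `[ab.1, ab.2]].
  by move=> v; have [a [b abP]] := dco_supp (m v); exists (a, b).
pose a := (\big[Num.min/1]_v (f v).1)%R.
pose b := (\big[Num.max/2]_v (f v).2)%R.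
exists a, b; split.
- by rewrite /a; elim/big_ind: _ => // [x y x0 y0|v _];
    [rewrite lt_min x0 y0|have [] := fP v].
- apply: (@le_lt_trans _ _ 1%R); first exact: bigmin_le_id.
  apply: (@lt_le_trans _ _ 2%R); first by rewrite ltr1n.
  exact: bigmax_ge_id.
move=> x xs; apply: contrapT => xab.
have H v : exists U : set R, [/\ open U, U x & m v U = 0].
  apply: contrapT => nU; apply: xab.
  have [_ _ /(_ x)] := fP v.
  have xm : supp (m v) x.
    move=> U oU Ux; rewrite lt0e measure_ge0 andbT; apply/eqP => mU0.
    by apply: nU; exists U.
  move=> /(_ xm); rewrite /= !in_itv /= => /andP[ax xb].
  apply/andP; split.
  - by apply: (@le_trans _ _ (f v).1%R) => //; exact: bigmin_le.
  - by apply: (@le_trans _ _ (f v).2%R) => //; exact: le_bigmax.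
have /boolp.choice[U UP] := H.
pose W : set R := [set y | forall v, U v y].
have Wx : nbhs x W.
  apply: (@filter_forall R V U (nbhs x)) => v; have [oU Ux _] := UP v; exact: open_nbhs_nbhs.
have := xs _ (open_interior W) Wx; rewrite ltNge => /negP; apply.
rewrite /mixture big1 // => v _; have [oU _ mU0] := UP v.
rewrite (_ : m v _ = 0) ?mule0//; apply/eqP; rewrite -measure_le0 -mU0.
apply: le_measure; rewrite ?inE.
- by apply: open_measurable; exact: open_interior.
- exact: open_measurable.
- by move=> y /interior_subset; exact.
Qed.

Definition dco_mixture : dco R := Dco supp_mixture.

End Mixture.

Record game (R : realType) := Game {
  strat1 : finType;
  strat2 : finType;
  strat1_neq0 : (0 < #|strat1|)%N;
  strat2_neq0 : (0 < #|strat2|)%N;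
  payoff1 : strat1 -> strat2 -> dco R;
  payoff2 : strat1 -> strat2 -> dco R }.

Arguments payoff1 {R} g _ _.
Arguments payoff2 {R} g _ _.

(* The biaffine extension of [u]: unfolding, a Borel set A has measure
   \sum_v1 s1 v1 * \sum_v2 s2 v2 * u v1 v2 A. *)
Definition mixed_payoff (R : realType) (V1 V2 : finType)
    (u : V1 -> V2 -> dco R) (s1 : mixed R V1) (s2 : mixed R V2) : dco R :=
  dco_mixture s1 (fun v1 => dco_mixture s2 (u v1)).

Definition identical_payoffs (R : realType) (G : game R) : Prop :=
  payoff1 G = payoff2 G.

(* Player 1 prefers payoffs that are large for [le], Player 2 payoffs that
   are small for [le]. *)
Definition nash_equilibrium (R : realType) (le : dco R -> dco R -> Prop)
    (G : game R) (s1 : mixed R (strat1 G)) (s2 : mixed R (strat2 G)) : Prop :=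
  (forall t1 : mixed R (strat1 G),
     le (mixed_payoff (payoff1 G) t1 s2)
        (mixed_payoff (payoff1 G) s1 s2)) /\
  (forall t2 : mixed R (strat2 G),
     le (mixed_payoff (payoff2 G) s1 s2)
        (mixed_payoff (payoff2 G) s1 t2)).

Definition finitely_supported_distribution (R : realType) (mu : dco R) : Prop :=
  mu [set: R] = 1%E /\ finite_set (supp mu).

(* Main.v *)
Require Import Defs.
From mathcomp Require Import all_boot all_order all_algebra.
From mathcomp Require Import all_classical all_reals all_analysis.
From mathcomp Require Import ring lra measurable_realfun.
Import Order.TTheory GRing.Theory Num.Theory.
Import numFieldNormedType.Exports.

(** Moments at large [n] are governed by the largest atoms: comparing two
finitely supported distributions in the tail order amounts to comparing
their masses lexicographically, from the largest support point downwards.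
A game with such payoffs is therefore a lexicographic zero-sum game, and such
games can lack equilibria: the equilibria of the leading component may all be
destroyed by the next one.

The game [pennies] realizes this with atoms at 4, 2 and 1. The mass at 4 is
a matching pennies game (one half if the two players make the same choice,
zero otherwise), which forces both players to randomize evenly; the mass
at 2 is one half if Player 1 plays [true] and zero otherwise, a bonus that
Player 2 cannot influence and that breaks Player 1's indifference. If Player 1
plays [true] with probability [p] and Player 2 with probability [q], the
[n]-th moment is [pennies_moment (2 ^+ n) p q], and with [a = 2 ^+ n]
- moving [p] to [p'] changes it by a positive multiple of
  [(p' - p) * ((2 * q - 1) * (a + 1) + 1)] ([pennies_moment_row]);
- moving [q] to [q'] changes it by a positive multiple of
  [(q' - q) * (2 * p - 1)] ([pennies_moment_col]).
If [1/2 <= q], the first line makes [p = 1] the only best reply, and against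
it the second makes [q = 0] the only best reply. If [q < 1/2], the bracket is
negative for large [a], so that [p = 0] is the only best reply, and against
it [q = 1] is. Hence no pair is stable ([pennies_unstable]).

The remaining work is to compute moments: they are affine under mixtures
([moment_dco_mixture]), and all payoffs are mixtures of Dirac masses. *)

Set Implicit Arguments.
Unset Strict Implicit.
Unset Printing Implicit Defensive.

Local Open Scope classical_set_scope.
Local Open Scope ring_scope.

Lemma supp_sub_closed (R : realType)
    (mu : set (measurableTypeR R) -> \bar R) (C : set R) :
  closed C -> mu (~` C) = 0%E -> supp mu `<=` C.
Proof.
move=> cC muC0 x xs; apply: contrapT => nCx.
by have := xs (~` C) (closed_openC cC) nCx; rewrite muC0 ltxx.
Qed.

(** The integral is additive in the measure for sums indexed by an initial
segment of the naturals, so the proof enumerates [V]. *)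
Lemma moment_dco_mixture (R : realType) (V : finType) (s : mixed R V)
    (m : V -> dco R) (n : nat) :
  moment (dco_mixture s m) n = (\sum_v (s v)%:E * moment (m v) n)%E.
Proof.
rewrite /moment.
pose D : set (measurableTypeR R) := `[0%R, +oo[%classic.
have mD : measurable D by exact: measurable_itv.
have f0 t : D t -> (0 <= ((t : R) ^+ n)%:E)%E.
  by rewrite /D /= in_itv /= andbT lee_fin => t0; exact: exprn_ge0.
have mf : measurable_fun D (fun t : R => (t ^+ n)%:E).
  by apply/measurable_EFinP; exact: measurable_funX.
(* [v0] only serves as default value when [V] is listed as a sequence. *)
case: (pickP (fun _ : V => true)) => [v0 _|V0]; last first.
  by have := mixed_sum1 s; rewrite big_pred0 // => /esym/eqP; rewrite oner_eq0.
pose ms v := mscale (NngNum (mixed_ge0 s v)) (m v).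
pose e (i : nat) := nth v0 (enum V) i.
transitivity (\int[msum (fun i => ms (e i)) (size (enum V))]_(t in D)
    (t ^+ n)%:E)%E.
  apply: eq_measure_integral => A mA AD /=.
  by rewrite /msum /mixture -big_enum (big_nth v0) big_mkord.
rewrite ge0_integral_measure_sum //.
rewrite -[RHS]big_enum (big_nth v0) big_mkord; apply: eq_bigr => i _.
by rewrite ge0_integral_mscale.
Qed.

Lemma dco_dirac_supp (R : realType) (x : {posnum R}) :
  exists a b : R, [/\ 0 < a, a < b
    & supp (dirac (x%:num : measurableTypeR R)) `<=` `[a, b]%classic].
Proof.
exists x%:num, (x%:num + 1); split; [by []|by rewrite ltrDl|].
apply: supp_sub_closed; first exact: itv_closed.
rewrite diracE memNset // => /=; apply.
by rewrite in_itv /= lexx lerDl ler01.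
Qed.

Definition dco_dirac (R : realType) (x : {posnum R}) : dco R :=
  @Dco R (dirac (x%:num : measurableTypeR R)) (dco_dirac_supp x).

Lemma moment_dco_dirac (R : realType) (x : {posnum R}) (n : nat) :
  moment (dco_dirac x) n = (x%:num ^+ n)%:E.
Proof.
rewrite /moment /= integral_dirac //.
- by rewrite diracE mem_set ?mul1e //= in_itv /= andbT.
- by apply/measurable_EFinP; exact: measurable_funX.
Qed.

Lemma fair_sum1 (R : realType) :
  \sum_(b : bool) [ffun _ : bool => 2^-1 : R] b = 1.
Proof. by rewrite big_bool /= !ffunE; field. Qed.

Definition fair_coin (R : realType) : mixed R bool.
Proof.
by apply: (Mixed _ (@fair_sum1 R)) => v; rewrite ffunE invr_ge0.
Defined.

Definition toss (R : realType) (x y : {posnum R}) : dco R :=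
  dco_mixture (fair_coin R) (fun b => dco_dirac (if b then x else y)).

Lemma moment_toss (R : realType) (x y : {posnum R}) (n : nat) :
  moment (toss x y) n = ((x%:num ^+ n + y%:num ^+ n) / 2)%:E.
Proof.
rewrite moment_dco_mixture big_bool !moment_dco_dirac /= !ffunE.
by rewrite -!EFinM -EFinD; congr EFin; lra.
Qed.

Lemma toss_finitely_supported (R : realType) (x y : {posnum R}) :
  finitely_supported_distribution (toss x y).
Proof.
have tossE A : toss x y A =
    ((2^-1)%:E * \d_(x%:num : measurableTypeR R) A
     + (2^-1)%:E * \d_(y%:num : measurableTypeR R) A)%E.
  by rewrite /= /mixture big_bool /= !ffunE.
split.
  by rewrite tossE !diracT !mule1 -EFinD; congr EFin; lra.
have fin2 : finite_set [set x%:num; y%:num] by exact: finite_set2.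
apply: sub_finite_set fin2; apply: supp_sub_closed.
  by apply: accessible_finite_set_closed.1 => //;
    apply: hausdorff_accessible; exact: norm_hausdorff.
rewrite tossE !diracE !memNset ?mule0 ?adde0 //= => -[].
- by right.
- by left.
Qed.

Lemma pure_sum1 (R : realType) (V : finType) (v0 : V) :
  \sum_v [ffun v => (v == v0)%:R : R] v = 1.
Proof.
rewrite (bigD1 v0) //= ffunE eqxx big1 ?addr0 // => v /negPf vv0.
by rewrite ffunE vv0.
Qed.

Definition pure (R : realType) (V : finType) (v0 : V) : mixed R V.
Proof.
by apply: (Mixed _ (@pure_sum1 R V v0)) => v; rewrite ffunE ler0n.
Defined.

Lemma mixed_false (R : realType) (s : mixed R bool) : s false = 1 - s true.
Proof. by rewrite -(mixed_sum1 s) big_bool /=; ring. Qed.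

(** Each pair of points is split into two halves: 4 occurs exactly on the
diagonal, and 2 exactly in the row [true]; the point 1 completes the total
mass. *)
Definition pennies (R : realType) (row col : bool) : dco R :=
  match row, col with
  | true, true => toss 4%:pos 2%:pos
  | true, false => toss 2%:pos 1%:pos
  | false, true => toss 1%:pos 1%:pos
  | false, false => toss 4%:pos 1%:pos
  end.

(** The [n]-th moment in terms of [a = 2 ^+ n]. As the largest atom is the
square of the middle one, [4 ^+ n = a ^+ 2], and the gain of Player 1 has the
positive factor [a - 1]. *)
Definition pennies_moment (R : realType) (a p q : R) : R :=
  1 + (p * q + (1 - p) * (1 - q)) * (a ^+ 2 - 1) / 2 + p * (a - 1) / 2.

Lemma moment_pennies (R : realType) (s t : mixed R bool) (n : nat) :
  moment (mixed_payoff (pennies R) s t) n =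
  (pennies_moment (2 ^+ n) (s true) (t true))%:E.
Proof.
rewrite moment_dco_mixture big_bool !moment_dco_mixture !big_bool /=.
rewrite !moment_toss !mixed_false -?(EFinM, EFinD).
congr EFin; rewrite /pennies_moment /= expr1n.
have -> : (4 : R) ^+ n = (2 ^+ n) ^+ 2.
  by rewrite exprAC; congr (_ ^+ _); ring.
by field.
Qed.

Definition pennies_game (R : realType) : game R.
Proof.
by apply: (@Game R bool bool _ _ (pennies R) (pennies R)); rewrite card_bool.
Defined.

Lemma pow2_unbounded (R : realType) (n0 : nat) (r : R) :
  exists2 n, (n0 <= n)%N & r < 2 ^+ n.
Proof.
pose n := maxn n0 (Num.truncn `|r|).+1.
exists n; first exact: leq_maxl.
apply: le_lt_trans (ler_norm r) _.
apply: lt_le_trans (truncnS_gt _) _.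
rewrite -natrX ler_nat; apply: leq_trans (ltnW (ltn_expl _ (ltnSn 1))).
exact: leq_maxr.
Qed.

Lemma pennies_moment_row (R : realType) (a p p' q : R) :
  pennies_moment a p' q - pennies_moment a p q =
  (p' - p) * ((2 * q - 1) * (a + 1) + 1) * ((a - 1) / 2).
Proof. by rewrite /pennies_moment; field. Qed.

Lemma pennies_moment_col (R : realType) (a p q q' : R) :
  pennies_moment a p q' - pennies_moment a p q =
  (q' - q) * (2 * p - 1) * ((a ^+ 2 - 1) / 2).
Proof. by rewrite /pennies_moment; field. Qed.

(** The sign of the second player's gain is the same for all [n > 0], so one
index suffices for [col]. In [row] the index must be taken large enough: for
small [a = 2 ^+ n], the bonus of the row [true] outweighs a slight
disadvantage in matching, and [(1 - 2 * q)^-1 < a] rules this out. *)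
Lemma pennies_unstable (R : realType) (p q : R) :
  0 <= p -> p <= 1 -> 0 <= q -> q <= 1 ->
  (forall b : bool, exists n0, forall n, (n0 <= n)%N ->
    pennies_moment (2 ^+ n) b%:R q <= pennies_moment (2 ^+ n) p q) ->
  (forall b : bool, exists n0, forall n, (n0 <= n)%N ->
    pennies_moment (2 ^+ n) p q <= pennies_moment (2 ^+ n) p b%:R) ->
  False.
Proof.
move=> p0 p1 q0 q1 row col.
have {}col (b : bool) : 0 <= (b%:R - q) * (2 * p - 1).
  have [n0 H] := col b; have [n nn0 a1] := pow2_unbounded n0 (1 : R).
  have := H n nn0; rewrite -subr_ge0 pennies_moment_col pmulr_lge0 //.
  by rewrite divr_gt0 ?ltr0n // subr_gt0 exprn_egt1.
have {}row (b : bool) r : exists2 a : R, r < a &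
    (b%:R - p) * ((2 * q - 1) * (a + 1) + 1) <= 0.
  have [n0 H] := row b.
  have [n nn0] := pow2_unbounded n0 (Num.max r 1).
  rewrite gt_max => /andP[ra a1]; exists (2 ^+ n) => //.
  have := H n nn0; rewrite -subr_le0 pennies_moment_row pmulr_lle0 //.
  by rewrite divr_gt0 ?ltr0n // subr_gt0.
have [q2|q2] := leP 2^-1 q.
- have [a a0 rowT] := row true 0.
  have gain : 0 < (2 * q - 1) * (a + 1) + 1.
    by apply: ltr_wpDl ltr01; apply: mulr_ge0; lra.
  have pE : p = 1 by rewrite pmulr_lle0 //= in rowT; lra.
  by have := col false; rewrite pE /=; lra.
have c0 : 0 < 1 - 2 * q by lra.
have [a ac rowF] := row false (1 - 2 * q)^-1.
have loss : (2 * q - 1) * (a + 1) + 1 < 0.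
  have : 1 < a * (1 - 2 * q) by rewrite -ltr_pdivrMr // div1r.
  by lra.
have pE : p = 0 by rewrite nmulr_lle0 //= in rowF; lra.
by have := col true; rewrite pE /=; lra.
Qed.

Theorem theorem23 (R : realType) :
  exists G : game R,
    [/\ identical_payoffs G,
        (forall (v1 : strat1 G) (v2 : strat2 G),
           finitely_supported_distribution (payoff1 G v1 v2) /\
           finitely_supported_distribution (payoff2 G v1 v2))
      & ~ exists (s1 : mixed R (strat1 G)) (s2 : mixed R (strat2 G)),
            nash_equilibrium (@tail_le R) s1 s2].
Proof.
exists (pennies_game R); split => //.
  by case=> -[]; split; exact: toss_finitely_supported.
move=> [s [t [nash1 nash2]]].
have p0 := mixed_ge0 s true; have p1 := mixed_ge0 s false.
have q0 := mixed_ge0 t true; have q1 := mixed_ge0 t false.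
rewrite mixed_false subr_ge0 in p1; rewrite mixed_false subr_ge0 in q1.
apply: (pennies_unstable p0 p1 q0 q1) => b.
- have [n0 H] := nash1 (pure R b); exists n0 => n /H.
  by rewrite /= !moment_pennies /= ffunE [true == b]eq_sym eqb_id lee_fin.
- have [n0 H] := nash2 (pure R b); exists n0 => n /H.
  by rewrite /= !moment_pennies /= ffunE [true == b]eq_sym eqb_id lee_fin.
Qed.
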